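(* Let $Q$ be a quiver such that $d:=\dim(\mathcal{M}(Q,0))>0$. Then the ideal of relations of $\mathcal{M}(Q,0)$ (the kernel of the surjection $\mathbb{C}[t_C\mid C\text{ a primitive cycle of }Q]\to\mathcal{O}(\mathcal{M}(Q,0))$, $t_C\mapsto x^{\varepsilon_C}$, graded by $\deg t_C=1$) is generated by elements of degree at most $d-1$.
   Context: A quiver $Q$: vertices $Q_0$, arrows $Q_1$ (loops, multiple arrows, oriented cycles allowed). $\mathcal{M}(Q,0)$ is the affine variety whose coordinate ring is the invariant ring $\mathcal{O}(\mathcal{M}(Q,0))=\mathbb{C}[x(a)\mid a\in Q_1]^{(\mathbb{C}^\times)^{Q_0}}$, where $g$ acts by $x(a)\mapsto g(a^+)x(a)g(a^-)^{-1}$. A primitive cycle is a minimal oriented cycle of $Q$ (an oriented cycle not passing through any vertex twice; loops included); $\varepsilon_C\in\mathbb{Z}^{Q_1}$ is the characteristic function of its arrow set and $x^{\varepsilon_C}=\prod_{a\in C}x(a)$. These monomials generate $\mathcal{O}(\mathcal{M}(Q,0))$, and declaring them to be of degree $1$ grades the polynomial ring above. *)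

(* Defs.v *)
From mathcomp Require Import all_boot all_algebra.
From mathcomp Require Import Rstruct complex.
From mathcomp Require Import mpoly.
Set Implicit Arguments. Unset Strict Implicit. Unset Printing Implicit Defensive.
Import GRing.Theory.
Local Open Scope ring_scope.

Definition CC : numClosedFieldType := (Rdefinitions.R)[i].

(* A quiver: a finite vertex type V, arrows 'I_m, tail src (= a^-) and
   head tgt (= a^+).  Loops, multiple arrows and oriented cycles allowed. *)

(* A primitive cycle, identified with its arrow set: an oriented cycle
   a_0, ..., a_(k-1) (k >= 1, head of a_i = tail of a_(i+1 mod k))
   whose vertices (the tails of its arrows) are pairwise distinct. *)
Definition is_prim_cycle (V : finType) (m : nat) (src tgt : 'I_m -> V)
    (C : {set 'I_m}) : Prop :=
  exists (a0 : 'I_m) (s' : seq 'I_m),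
    let s := a0 :: s' in
    [/\ uniq (map src s),
        C = [set a in s] &
        forall i, (i < size s)%N ->
          tgt (nth a0 s i) = src (nth a0 s ((i + 1) %% size s))].

Definition quiver_invariant (V : finType) (m : nat) (src tgt : 'I_m -> V)
    (p : {mpoly CC[m]}) : Prop :=
  forall g : V -> CC, (forall v, g v != 0) ->
    comp_mpoly [tuple (g (tgt a) / g (src a)) *: 'X_a | a < m] p = p.

Definition ideal_in (R : comNzRingType) (S : R -> Prop) (P : R -> Prop) : Prop :=
  [/\ forall x, P x -> S x,
      P 0,
      forall x y, P x -> P y -> P (x - y) &
      forall r x, S r -> P x -> P (r * x)].

Definition prime_ideal_in (R : comNzRingType) (S : R -> Prop) (P : R -> Prop) : Prop :=
  [/\ ideal_in S P, ~ P 1 &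
      forall x y, S x -> S y -> P (x * y) -> P x \/ P y].

Definition prime_chain_in (R : comNzRingType) (S : R -> Prop) (k : nat)
    (P : nat -> R -> Prop) : Prop :=
  (forall i, (i <= k)%N -> prime_ideal_in S (P i)) /\
  (forall i, (i < k)%N ->
     (forall x, P i x -> P i.+1 x) /\ exists x, P i.+1 x /\ ~ P i x).

Definition krull_dim (R : comNzRingType) (S : R -> Prop) (d : nat) : Prop :=
  (exists P, prime_chain_in S d P) /\ ~ (exists P, prime_chain_in S d.+1 P).

(* The surjection C[t_C | C primitive] -> O(M(Q,0)), t_i |-> x^{eps_(cyc i)},
   where cyc : 'I_N -> {set 'I_m} enumerates the primitive cycles. *)
Definition prim_cycle_map (m N : nat) (cyc : 'I_N -> {set 'I_m})
    (p : {mpoly CC[N]}) : {mpoly CC[m]} :=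
  comp_mpoly [tuple (\prod_(a in cyc i) 'X_a : {mpoly CC[m]}) | i < N] p.

(* Main.v *)
(**
The kernel is spanned by the binomials [t^u - t^v] where [u] and [v] are
multisets of primitive cycles with the same total arrow weight. Two such
multisets sharing a cycle [C] differ by [t_C] times a binomial of smaller
weight, so by induction it suffices to join [u] and [v] by steps that either
share a cycle or involve multisets of fewer than [d] cycles. Let [u] have at
least [d] cycles and let [D] be a cycle of [v]. Take a minimal family [J] of
cycles of [u] covering [D], and suppose [D] is not in [J]. Then the weight of
[J] minus [D] is a nonnegative circulation, hence a sum of primitive cycles;
replacing [J] by [D] and these gives a multiset sharing [D] with [v], and
sharing a cycle with [u] as soon as [#|J| < d].

This last inequality comes from a chain of [#|J| + 2] primes: by minimality each
[C] in [J] has an arrow on [D] lying on no other member of [J], and one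
specializes to [1] all the variables but those of the first [l] of these arrows,
for [l = #|J|, ..., 0]. The chain starts with the zero ideal, which differs from
the first kernel since [D] is not the sum of the members of [J].
*)

Require Import Defs.
From mathcomp Require Import all_boot all_algebra.
From mathcomp Require Import Rstruct complex.
From mathcomp Require Import mpoly.
Set Implicit Arguments. Unset Strict Implicit. Unset Printing Implicit Defensive.
Import GRing.Theory.
Local Open Scope ring_scope.

(** * Eventual periodicity and lengths of prime chains *)

Lemma iter_cycle (T : finType) (h : T -> T) x :
  exists i k, iter k.+1 h (iter i h x) = iter i h x.
Proof.
have /injectivePn[i [j neq_ij eq_ij]] :
    ~~ injectiveb (fun i : 'I_#|T|.+1 => iter i h x).
  by apply/negP=> /injectiveP/leq_card; rewrite card_ord ltnn.
wlog lt_ij : i j neq_ij eq_ij / (i < j)%N => [wl|].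
  case: (ltngtP i j) => [||/val_inj eqij]; first exact: wl.
    by apply: wl; rewrite 1?eq_sym.
  by rewrite eqij eqxx in neq_ij.
exists i, (j - i.+1)%N.
by rewrite -iterD addSn -addnS subnK.
Qed.

(** [krull_dim] excludes only chains of length exactly [d.+1]; a longer one is truncated. *)
Lemma prime_chain_le (R : comNzRingType) (S : R -> Prop) d k P :
  krull_dim S d -> prime_chain_in S k P -> (k <= d)%N.
Proof.
case=> _ no_chain [primeP incP]; rewrite leqNgt; apply/negP=> lt_dk.
apply: no_chain; exists P; split=> i le_id; first exact/primeP/(leq_trans le_id).
exact/incP/(leq_trans le_id).
Qed.

Lemma mnm_neq0 n (u : 'X_{1..n}) : (u != 0%MM) = [exists j, (0 < u j)%N].
Proof.
rewrite -mdeg_eq0 mdegE sum_nat_eq0 negb_forall.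
by apply: eq_existsb => j; rewrite /= lt0n.
Qed.

(** * Primitive cycles and circulations on a quiver *)

Section Circulations.
Variables (V : finType) (m : nat) (src tgt : 'I_m -> V).
Implicit Types (C D A : {set 'I_m}) (f : 'I_m -> nat) (v : V).

(** With the heads as a rotation of the tails, modular indices disappear and sums over a cycle
    compare by permutation. *)
Lemma prim_cycleP C : is_prim_cycle src tgt C <->
  exists s, [/\ s != [::], uniq (map src s), C = [set a in s] &
                map tgt s = rot 1 (map src s)].
Proof.
have nthE a0 s' i : (i < (size s').+1)%N ->
    nth (src a0) (rot 1 (map src (a0 :: s'))) i =
    src (nth a0 (a0 :: s') ((i + 1) %% (size s').+1)).
  move=> lti; rewrite /= rot1_cons nth_rcons size_map addn1.
  rewrite ltnS in lti; case: ltngtP lti => // [lti _|-> _]; last by rewrite modnn.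
  by rewrite modn_small // (nth_map a0).
split=> [[a0 [s' [us -> tgts]]]|[s [+ us -> tgts]]].
  exists (a0 :: s'); split=> //.
  apply: (@eq_from_nth _ (src a0)) => [|i]; rewrite ?size_rot !size_map //.
  by move=> lti; rewrite (nth_map a0) // tgts // nthE.
case: s us tgts => // a0 s' us tgts _; exists a0, s'; split=> // i lti.
by rewrite -nthE // -tgts (nth_map a0).
Qed.

Lemma prim_cycle_neq0 C : is_prim_cycle src tgt C -> C != set0.
Proof.
by case=> a0 [s' [_ -> _]]; apply/set0Pn; exists a0; rewrite inE mem_head.
Qed.

Lemma big_prim_cycle (R : Type) (idx : R) (op : Monoid.com_law idx)
    (F : V -> R) C : is_prim_cycle src tgt C ->
  \big[op/idx]_(a in C) F (tgt a) = \big[op/idx]_(a in C) F (src a).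
Proof.
case/prim_cycleP=> s [_ us -> tgts].
have bigE (G : 'I_m -> R) :
    \big[op/idx]_(a in [set a in s]) G a = \big[op/idx]_(a <- s) G a.
  by rewrite (big_uniq _ (map_uniq us)); apply: eq_bigl => a; rewrite inE.
rewrite !bigE -(big_map tgt predT) -[RHS](big_map src predT) /= tgts.
by apply: perm_big; rewrite perm_rot.
Qed.

Lemma prim_cycle_src_inj C : is_prim_cycle src tgt C -> {in C &, injective src}.
Proof.
case/prim_cycleP=> s [_ us -> _] a b; rewrite !inE => sa sb eqab.
have: nth (src a) (map src s) (index a s) = nth (src a) (map src s) (index b s).
  by rewrite !(nth_map a) ?index_mem // !nth_index.
move/eqP; rewrite nth_uniq ?size_map ?index_mem // => /eqP eqi.
by rewrite -(nth_index a sa) eqi nth_index.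
Qed.

Lemma prim_cycle_next C a : is_prim_cycle src tgt C -> a \in C ->
  exists2 b, b \in C & src b = tgt a.
Proof.
case/prim_cycleP=> s [_ us -> tgts]; rewrite inE => /(map_f tgt).
by rewrite tgts mem_rot => /mapP[b sb ->]; exists b; rewrite ?inE.
Qed.

(** Following [C] from [a] never leaves [A], and this walk meets every arrow of [C]. *)
Lemma prim_cycle_closed C A a : is_prim_cycle src tgt C -> a \in C -> a \in A ->
  {in A & C, forall b c, src c = tgt b -> c \in A} -> C \subset A.
Proof.
case=> a0 [s' [us -> tgts]]; rewrite inE; set s := a0 :: s' => sa Aa clA.
have Aiter j : nth a0 s ((index a s + j) %% size s) \in A.
  elim: j => [|j IHj]; first by rewrite addn0 modn_small ?index_mem // nth_index.
  apply: clA IHj _ _; first by rewrite inE mem_nth // ltn_mod.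
  by rewrite tgts ?ltn_mod // modnDml addnS addn1.
apply/subsetP=> b; rewrite inE => sb.
have := Aiter (index b s + (size s - index a s))%N.
rewrite addnCA subnKC; last by rewrite ltnW ?index_mem.
by rewrite modnDr modn_small ?index_mem // nth_index.
Qed.

(** Tails are distinct on [D], so the successor in [D] of an arrow of [C] is its successor in
    [C]. *)
Lemma prim_cycle_sub C D : is_prim_cycle src tgt C -> is_prim_cycle src tgt D ->
  C \subset D -> C = D.
Proof.
move=> pC pD sCD; apply/eqP; rewrite eqEsubset sCD /=.
have /set0Pn[a Ca] := prim_cycle_neq0 pC.
apply: (prim_cycle_closed (a := a) pD) => // [|b c Cb Dc eq_cb].
  exact: (subsetP sCD).
have [c' Cc' eq_c'b] := prim_cycle_next pC Cb.
suff -> : c = c' by [].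
by apply: (prim_cycle_src_inj pD) => //; rewrite ?(subsetP sCD) ?eq_cb.
Qed.

Definition circulation f :=
  forall v, (\sum_(a | tgt a == v) f a = \sum_(a | src a == v) f a)%N.

Lemma circulationB (f g : 'X_{1..m}) :
  circulation f -> circulation g -> (g <= f)%MM ->
  circulation (f - g)%MM.
Proof.
move=> cf cg /mnm_lepP le_gf v.
have sub h : (\sum_(a | h a == v) (f - g)%MM a =
    \sum_(a | h a == v) f a - \sum_(a | h a == v) g a)%N.
  by rewrite -sumnB //; apply: eq_bigr => a _; rewrite mnmBE.
by rewrite !sub cf cg.
Qed.

Lemma prim_cycle_circulation C : is_prim_cycle src tgt C ->
  circulation (fun a => a \in C).
Proof.
move=> pC v; have := big_prim_cycle addn (fun w => nat_of_bool (w == v)) pC.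
rewrite [in LHS]big_mkcond [in RHS]big_mkcond /= => eqv.
rewrite big_mkcond [RHS]big_mkcond /=.
transitivity (\sum_a (if a \in C then nat_of_bool (tgt a == v) else 0))%N.
  by apply: eq_bigr => a _; case: (a \in C); case: (tgt a == v).
by rewrite eqv; apply: eq_bigr => a _; case: (a \in C); case: (src a == v).
Qed.

(** Conservation lets a walk along arrows with [f] positive always continue; it becomes periodic,
    and one period visits each of its vertices once. *)
Lemma circulation_cycle f a0 : circulation f -> (0 < f a0)%N ->
  exists2 C, is_prim_cycle src tgt C & {in C, forall a, (0 < f a)%N}.
Proof.
move=> circ f0.
pose P v := [exists a, (src a == v) && (0 < f a)%N].
(* Only vertices satisfying [P] matter below, and there the default [a0] is not taken. *)
pose out v := odflt a0 [pick a | (src a == v) && (0 < f a)%N].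
pose step v := tgt (out v).
have outP v : P v -> src (out v) = v /\ (0 < f (out v))%N.
  rewrite /out => /existsP[a Pa]; case: pickP => [b /andP[/eqP]//|/(_ a)].
  by rewrite Pa.
have PtgtP a : (0 < f a)%N -> P (tgt a).
  move=> fa; apply: contraLR isT => nP.
  have /eqP := circ (tgt a); rewrite (bigD1 a) //= [X in _ == X]big1.
    by rewrite addn_eq0 -leqn0 leqNgt fa.
  move=> b /eqP eqb; apply/eqP; rewrite -leqn0 leqNgt; apply: contra nP => fb.
  by apply/existsP; exists b; rewrite eqb eqxx.
have Piter k v : P v -> P (iter k step v).
  by move=> Pv; elim: k => //= k /outP[_ /PtgtP].
have [i [k periodic]] := iter_cycle step (tgt a0).
set x := iter i step (tgt a0) in periodic.
have Px : P x by apply/Piter/PtgtP.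
have Porb v : v \in orbit step x -> P v.
  by rewrite -fconnect_orbit => /iter_findex <-; apply: Piter.
have srcE : map src (map out (orbit step x)) = orbit step x.
  rewrite -map_comp -[RHS]map_id; apply/eq_in_map => v /Porb Pv /=.
  by case: (outP v Pv).
exists [set a in map out (orbit step x)]; last first.
  by move=> a; rewrite inE => /mapP[v /Porb/outP[_ fv] ->].
apply/prim_cycleP; exists (map out (orbit step x)); rewrite srcE orbit_uniq.
split=> //; first by rewrite -size_eq0 size_map size_orbit -lt0n order_gt0.
(* As [step] need not be injective, the orbit closes up at [x] only because [x] is periodic. *)
have perO : iter (order step x) step x = x.
  have per : exists k, iter k.+1 step x = x by exists k.
  exact: (all_iffLR (@orbitPcycle V step x) 3 4 per).
rewrite -map_comp /orbit; case: (order step x) (order_gt0 step x) perO => // n _.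
rewrite iterSr => perO.
rewrite [in RHS]trajectS rot1_cons -[X in rcons _ X]perO -trajectSr.
by elim: n.+1 (x) => //= l IHl y; rewrite IHl.
Qed.

End Circulations.

(** * Specializing variables to 1 *)

Section RestrictVariables.
Variable m : nat.
Implicit Types (A B : {set 'I_m}) (w : 'X_{1..m}) (p q : {mpoly CC[m]}).

Definition restrict_vars A p : {mpoly CC[m]} :=
  comp_mpoly [tuple if a \in A then 'X_a else 1 | a < m] p.

Definition restrict_mnm A w : 'X_{1..m} :=
  [multinom if a \in A then w a else 0%N | a < m].

Lemma restrict_vars0 A : restrict_vars A 0 = 0.
Proof. exact: raddf0. Qed.

Lemma restrict_varsB A p q :
  restrict_vars A (p - q) = restrict_vars A p - restrict_vars A q.
Proof. exact: raddfB. Qed.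

Lemma restrict_varsM A p q :
  restrict_vars A (p * q) = restrict_vars A p * restrict_vars A q.
Proof. exact: rmorphM. Qed.

Lemma restrict_varsX A w : restrict_vars A 'X_[w] = 'X_[restrict_mnm A w].
Proof.
rewrite /restrict_vars comp_mpolyX mpolyXE_id; apply: eq_bigr => a _.
by rewrite tnth_mktuple mnmE; case: ifP => // _; rewrite expr1n.
Qed.

Lemma restrict_varsE A p :
  restrict_vars A p = \sum_(w <- msupp p) p@_w *: 'X_[restrict_mnm A w].
Proof.
rewrite /restrict_vars comp_mpolyEX; apply: eq_bigr => w _.
by congr (_ *: _); apply: restrict_varsX.
Qed.

Lemma restrict_varsT p : restrict_vars setT p = p.
Proof.
rewrite restrict_varsE [RHS]mpolyE; apply: eq_bigr => w _.
by congr (_ *: 'X_[_]); apply/mnmP=> a; rewrite mnmE inE.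
Qed.

Lemma restrict_vars_sub A B p : A \subset B ->
  restrict_vars A (restrict_vars B p) = restrict_vars A p.
Proof.
move=> sAB; rewrite (restrict_varsE B) [RHS]restrict_varsE.
rewrite /restrict_vars raddf_sum /=; apply: eq_bigr => w _; rewrite comp_mpolyZ.
congr (_ *: _); rewrite -[LHS]/(restrict_vars A _) restrict_varsX.
congr 'X_[_]; apply/mnmP=> a; rewrite !mnmE.
by case: ifP => // /(subsetP sAB) ->.
Qed.

End RestrictVariables.

(** * Invariant polynomials and the primes cut out by specialization *)

Section Invariants.
Variables (V : finType) (m : nat) (src tgt : 'I_m -> V).
Implicit Types (p q : {mpoly CC[m]}) (A : {set 'I_m}).

Local Notation invariant := (quiver_invariant src tgt).

Lemma invariant0 : invariant 0.
Proof. by move=> g _; rewrite raddf0. Qed.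

Lemma invariantB p q : invariant p -> invariant q -> invariant (p - q).
Proof. by move=> ip iq g g0; rewrite raddfB /= ip ?iq. Qed.

Lemma invariantM p q : invariant p -> invariant q -> invariant (p * q).
Proof. by move=> ip iq g g0; rewrite rmorphM /= ip ?iq. Qed.

(** The torus element [g] scales ['X_[w]] by the product over [v] of [g v] to the power inflow minus
    outflow. *)
Lemma invariantX (w : 'X_{1..m}) : circulation src tgt w -> invariant 'X_[w].
Proof.
move=> circ g g0; rewrite comp_mpolyX.
have bigE (h : 'I_m -> V) : \prod_a g (h a) ^+ w a =
    \prod_v g v ^+ (\sum_(a | h a == v) w a).
  rewrite (partition_big h predT) //=; apply: eq_bigr => v _.
  by rewrite expr_sum; apply: eq_bigr => a /eqP ->.
transitivity (((\prod_a g (tgt a) ^+ w a) / (\prod_a g (src a) ^+ w a))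
              *: 'X_[w] : {mpoly CC[m]}).
  rewrite mpolyXE_id -prodf_div -scaler_prod; apply: eq_bigr => a _.
  by rewrite tnth_mktuple exprZn expr_div_n.
rewrite !bigE (eq_bigr (fun v => g v ^+ (\sum_(a | src a == v) w a))).
  by rewrite divff ?scale1r //; apply/prodf_neq0 => v _; rewrite expf_neq0.
by move=> v _; rewrite circ.
Qed.

(** Specialization is a ring morphism into a domain, so its kernel meets the invariant ring in a
    prime ideal. *)
Lemma restrict_kernel_prime A :
  prime_ideal_in invariant (fun p => invariant p /\ restrict_vars A p = 0).
Proof.
split; first split.
- by move=> p [].
- by split; [apply: invariant0 | rewrite restrict_vars0].
- move=> p q [ip p0] [iq q0]; split; first exact: invariantB.
  by rewrite restrict_varsB p0 q0 subr0.
- move=> p q ip [iq q0]; split; first exact: invariantM.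
  by rewrite restrict_varsM q0 mulr0.
- by case=> _; rewrite /restrict_vars comp_mpoly1 => /eqP; rewrite oner_eq0.
move=> p q ip iq [_]; rewrite restrict_varsM => /eqP.
by rewrite mulf_eq0 => /orP[] /eqP; [left | right].
Qed.

End Invariants.

(** * Weights of multisets of cycles and the kernel of a monomial map *)

Section CycleWeights.
Variables (m N : nat) (cyc : 'I_N -> {set 'I_m}).
Implicit Types (u v : 'X_{1..N}) (J : {set 'I_N}).

(** With [u] read as a multiset of cycles, this is the exponent of the image of ['X_[u]]. *)
Definition cycle_weight u : 'X_{1..m} :=
  [multinom (\sum_i u i * (a \in cyc i))%N | a < m].

Definition mnm_set J : 'X_{1..N} := [multinom (i \in J : nat) | i < N].

Lemma cycle_weightE u a : cycle_weight u a = (\sum_i u i * (a \in cyc i))%N.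
Proof. exact: mnmE. Qed.

Lemma cycle_weightD u v :
  cycle_weight (u + v)%MM = (cycle_weight u + cycle_weight v)%MM.
Proof.
apply/mnmP=> a; rewrite mnmDE !cycle_weightE -big_split /=.
by apply: eq_bigr => i _; rewrite mnmDE mulnDl.
Qed.

Lemma cycle_weight0 : cycle_weight 0%MM = 0%MM.
Proof.
apply/mnmP=> a; rewrite cycle_weightE mnm0E big1 // => i _.
by rewrite mnm0E mul0n.
Qed.

Lemma cycle_weightU i a : cycle_weight U_(i)%MM a = (a \in cyc i).
Proof.
rewrite cycle_weightE (bigD1 i) //= mnm1E eqxx mul1n big1 ?addn0 // => j.
by rewrite eq_sym mnm1E => /negbTE ->.
Qed.

Lemma cycle_weight_set J a :
  cycle_weight (mnm_set J) a = (\sum_(j in J) (a \in cyc j))%N.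
Proof.
rewrite cycle_weightE [RHS]big_mkcond; apply: eq_bigr => i _.
by rewrite mnmE; case: (i \in J); rewrite ?mul1n ?mul0n.
Qed.

Lemma mdeg_mnm_set J : mdeg (mnm_set J) = #|J|.
Proof.
rewrite mdegE -sum1_card [RHS]big_mkcond; apply: eq_bigr => i _.
by rewrite mnmE; case: (i \in J).
Qed.

Lemma prim_cycle_mapX u : prim_cycle_map cyc 'X_[u] = 'X_[cycle_weight u].
Proof.
rewrite /prim_cycle_map comp_mpolyX [RHS]mpolyXE_id.
under eq_bigr => i _ do rewrite tnth_mktuple -prodrXl big_mkcond /=.
rewrite exchange_big /=; apply: eq_bigr => a _.
rewrite cycle_weightE expr_sum; apply: eq_bigr => i _.
by case: (a \in cyc i); rewrite ?muln1 ?muln0.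
Qed.

Lemma prim_cycle_mapE p : prim_cycle_map cyc p =
  \sum_(u <- msupp p) p@_u *: 'X_[cycle_weight u].
Proof.
rewrite /prim_cycle_map comp_mpolyEX; apply: eq_bigr => u _.
by congr (_ *: _); apply: prim_cycle_mapX.
Qed.

(* Collapse the monomials of [p] of equal weight to one representative: what
   remains is the image of [p], spread over the representatives. *)
Lemma prim_cycle_map_kernel (I : {mpoly CC[N]} -> Prop) :
  I 0 -> (forall p q, I p -> I q -> I (p + q)) ->
  (forall p q, I q -> I (p * q)) ->
  (forall u v, cycle_weight u = cycle_weight v -> I ('X_[u] - 'X_[v])) ->
  forall p, prim_cycle_map cyc p = 0 -> I p.
Proof.
move=> I0 ID IM Ibin p p0.
pose W := undup (map cycle_weight (msupp p)).
pose rep w := nth 0%MM (msupp p) (find (fun u => cycle_weight u == w) (msupp p)).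
have repP u : u \in msupp p -> cycle_weight (rep (cycle_weight u)) = cycle_weight u.
  move=> pu; apply/eqP; apply: (@nth_find _ 0%MM (fun v => cycle_weight v == _)).
  by apply/hasP; exists u.
have collapse0 : \sum_(u <- msupp p) p@_u *: 'X_[rep (cycle_weight u)] = 0
    :> {mpoly CC[N]}.
  transitivity (\sum_(w <- W)
      (\sum_(u <- msupp p) p@_u * (cycle_weight u == w)%:R) *: 'X_[rep w]
      : {mpoly CC[N]}).
    under [RHS]eq_bigr => w _ do rewrite scaler_suml.
    rewrite exchange_big /= big_seq [RHS]big_seq; apply: eq_bigr => u pu.
    have Wu : cycle_weight u \in W by rewrite mem_undup map_f.
    rewrite (bigD1_seq (cycle_weight u)) ?undup_uniq //= eqxx mulr1.
    rewrite [X in _ + X]big1 ?addr0 // => w.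
    by rewrite eq_sym => /negbTE ->; rewrite mulr0 scale0r.
  rewrite big1_seq // => w _.
  (* This sum is the coefficient of ['X_[w]] in the image of [p]. *)
  suff -> : \sum_(u <- msupp p) p@_u * (cycle_weight u == w)%:R = 0.
    by rewrite scale0r.
  have /(congr1 (mcoeff w)) := p0; rewrite mcoeff0 prim_cycle_mapE raddf_sum /=.
  by move=> w0; rewrite -[RHS]w0; apply: eq_bigr => u _; rewrite mcoeffZ mcoeffX.
have -> : p = \sum_(u <- msupp p)
    (p@_u *: 'X_[u] - p@_u *: 'X_[rep (cycle_weight u)]).
  by rewrite sumrB collapse0 subr0 -mpolyE.
rewrite big_seq; elim/big_rec: _ => // u q pu Iq; apply: ID => //.
by rewrite -scalerBr -mul_mpolyC; apply/IM/Ibin; rewrite repP.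
Qed.

End CycleWeights.

(** * Exchange of cycles and the binomial relations *)

Section PrimitiveCycleRelations.
Variables (V : finType) (m : nat) (src tgt : 'I_m -> V).
Variables (N : nat) (cyc : 'I_N -> {set 'I_m}).
Hypothesis cyc_inj : injective cyc.
Hypothesis cycP :
  forall C : {set 'I_m}, is_prim_cycle src tgt C <-> exists i, cyc i = C.
Implicit Types (u v w : 'X_{1..N}) (i j : 'I_N) (J : {set 'I_N}).

Local Notation weight := (cycle_weight cyc).

Lemma cyc_prim i : is_prim_cycle src tgt (cyc i).
Proof. by apply/cycP; exists i. Qed.

Lemma cyc_sub i j : cyc i \subset cyc j -> i = j.
Proof. by move=> sij; apply/cyc_inj/(prim_cycle_sub (cyc_prim i) (cyc_prim j)). Qed.

Lemma cyc_weight_circulation u : circulation src tgt (weight u).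
Proof.
move=> v; under eq_bigr => a _ do rewrite cycle_weightE.
under [RHS]eq_bigr => a _ do rewrite cycle_weightE.
rewrite exchange_big [RHS]exchange_big; apply: eq_bigr => i _ /=.
by rewrite -!big_distrr /= (prim_cycle_circulation (cyc_prim i)).
Qed.

Lemma weight_eq0 u : weight u = 0%MM -> u = 0%MM.
Proof.
move/mnmP=> wu0; apply/mnmP=> i; rewrite mnm0E.
have /set0Pn[a ia] := prim_cycle_neq0 (cyc_prim i).
have /eqP := wu0 a; rewrite cycle_weightE mnm0E (bigD1 i) //= ia muln1.
by rewrite addn_eq0 => /andP[/eqP].
Qed.

(** A nonzero circulation has a primitive cycle in its support; subtracting it leaves a circulation
    of smaller degree. *)
Lemma circulation_weight (f : 'X_{1..m}) :
  circulation src tgt f -> exists u, weight u = f.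
Proof.
have [n] := ubnP (mdeg f); elim: n f => // n IHn f le_fn circ.
have [->|] := eqVneq f 0%MM; first by exists 0%MM; rewrite cycle_weight0.
rewrite -mdeg_eq0 mdegE sum_nat_eq0 negb_forall => /existsP[a fa].
rewrite /= -lt0n in fa.
have [C /cycP[i <-] posC] := circulation_cycle circ fa.
have le_if : (weight U_(i) <= f)%MM.
  apply/mnm_lepP=> b; rewrite cycle_weightU.
  by case: (boolP (b \in cyc i)) => // /posC.
have [||u wu] := IHn (f - weight U_(i))%MM.
- rewrite -ltnS (leq_trans _ le_fn) // ltnS -{2}(submK le_if) mdegD -addn1.
  rewrite leq_add2l lt0n mdeg_eq0; apply/eqP=> /weight_eq0/eqP.
  by rewrite -mdeg_eq0 mdeg1.
- exact: circulationB circ (cyc_weight_circulation _) le_if.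
by exists (u + U_(i))%MM; rewrite cycle_weightD wu submK.
Qed.

(* The kernels of [x_a |-> 1] for [a] outside an initial segment of the chosen
   arrows, together with the zero ideal, form a chain of [#|J| + 2] primes:
   the binomial [x^(cyc i) - \prod_(j in J) x^(cyc j)] lies in all of them but
   the zero ideal, and [x^(cyc j) - 1] separates consecutive kernels. *)
Lemma private_arrows_lt_dim d i J (arr : 'I_N -> 'I_m) :
  krull_dim (quiver_invariant src tgt) d -> J != set0 -> i \notin J ->
  {in J, forall j, arr j \in cyc i} ->
  {in J &, forall j j', (arr j \in cyc j') = (j == j')} ->
  (#|J| < d)%N.
Proof.
move=> dimd /set0Pn[j0 Jj0] J'i arr_i arr_J.
pose s := enum J; pose seg t := [set arr j | j in take t s].
(* [A 0] keeps all variables and gives the zero ideal; [A t.+1] keeps the first [#|J| - t] arrows,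
   down to none at [t = #|J|]. *)
pose A t := if t is t'.+1 then seg (#|J| - t')%N else setT.
have sJ j : j \in s = (j \in J) by rewrite mem_enum.
have size_s : size s = #|J| by rewrite -cardE.
have invw u : quiver_invariant src tgt 'X_[weight u].
  exact/invariantX/cyc_weight_circulation.
have mem_seg t j : j \in J -> (arr j \in seg t) = (j \in take t s).
  move=> Jj; apply/imsetP/idP => [[j' tj' eq_arr]|tj]; last by exists j.
  have Jj' : j' \in J by rewrite -sJ (mem_take tj').
  by have := arr_J _ _ Jj Jj'; rewrite eq_arr arr_J // eqxx => /esym/eqP ->.
have sub_seg t t' : (t <= t')%N -> seg t \subset seg t'.
  move=> le_tt'; apply/subsetP=> _ /imsetP[j tj ->]; apply/imsetP; exists j => //.
  by move: tj; rewrite -(take_takel s le_tt') => /mem_take.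
have sub_A t : A t.+1 \subset A t.
  by case: t => [|t]; rewrite ?subsetT //; apply: sub_seg; rewrite leq_sub2l.
suff: prime_chain_in (quiver_invariant src tgt) #|J|.+1
    (fun t p => quiver_invariant src tgt p /\ restrict_vars (A t) p = 0).
  exact: prime_chain_le.
split=> [t _|t le_t]; first exact: restrict_kernel_prime.
split=> [p [invp p0]|].
  split; first exact: invp.
  by rewrite -(restrict_vars_sub p (sub_A t)) p0 restrict_vars0.
have restrictB B u v : restrict_vars B ('X_[weight u] - 'X_[weight v]) =
    'X_[restrict_mnm B (weight u)] - 'X_[restrict_mnm B (weight v)].
  by rewrite restrict_varsB !restrict_varsX.
have neqX (f g : 'X_{1..m}) : f != g -> 'X_[f] - 'X_[g] <> 0 :> {mpoly CC[m]}.
  move=> neq_fg /(congr1 (mcoeff f)) /eqP.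
  by rewrite mcoeffB !mcoeffX eqxx [g == f]eq_sym (negbTE neq_fg) subr0 mcoeff0 oner_eq0.
case: t le_t => [_|t lt_t].
  exists ('X_[weight U_(i)] - 'X_[weight (mnm_set J)]).
  have sumJ j : j \in J -> (\sum_(j' in J) (arr j \in cyc j') = 1)%N.
    move=> Jj; rewrite (bigD1 j) //= arr_J // eqxx big1 // => j' /andP[Jj'].
    by rewrite arr_J // eq_sym => /negbTE ->.
  have inv : quiver_invariant src tgt
      ('X_[weight U_(i)] - 'X_[weight (mnm_set J)]) by apply: invariantB.
  split; [split; first exact: inv | case=> _].
    rewrite restrictB; apply/eqP; rewrite subr_eq0; apply/eqP.
    congr 'X_[_]; apply/mnmP=> a; rewrite !mnmE.
    case: ifP => // /imsetP[j tj ->].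
    have Jj : j \in J by rewrite -sJ (mem_take tj).
    have := cycle_weightU cyc i (arr j); have := cycle_weight_set cyc J (arr j).
    by rewrite !cycle_weightE => -> ->; rewrite sumJ // arr_i.
  rewrite restrict_varsT; apply: neqX; apply/eqP=> /mnmP eq_w.
  (* Equal weights would put every arrow of [cyc j0] on [cyc i], but distinct primitive cycles are
     incomparable. *)
  suff eq_j0i : j0 = i by rewrite -eq_j0i Jj0 in J'i.
  apply: cyc_sub; apply/subsetP=> a j0a.
  have := eq_w a; rewrite cycle_weightU cycle_weight_set (bigD1 j0) //= j0a.
  by case: (a \in cyc i).
rewrite ltnS in lt_t.
(* [arr j] is the one arrow kept by [A t.+1] and dropped by [A t.+2]. *)
pose j := nth j0 s (#|J| - t.+1)%N.
have lt_j : (#|J| - t.+1 < size s)%N by rewrite size_s subnSK // leq_subr.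
have Jj : j \in J by rewrite -sJ mem_nth.
have take_j : take (#|J| - t) s = rcons (take (#|J| - t.+1) s) j.
  by rewrite -subnSK // (take_nth j0).
have notin_take_j : j \notin take (#|J| - t.+1) s.
  have := take_uniq (#|J| - t)%N (enum_uniq J).
  by rewrite -/s take_j rcons_uniq => /andP[].
exists ('X_[weight U_(j)] - 'X_[weight 0%MM]); split.
  split; first exact: invariantB.
  rewrite restrictB; apply/eqP; rewrite subr_eq0; apply/eqP.
  congr 'X_[_]; apply/mnmP=> a; rewrite [LHS]mnmE [RHS]mnmE.
  rewrite cycle_weight0 cycle_weightU mnm0E.
  case: ifP => // /imsetP[j' tj' ->].
  have Jj' : j' \in J by rewrite -sJ (mem_take tj').
  rewrite arr_J //; case: eqP => // eqj; rewrite -eqj in notin_take_j.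
  by rewrite tj' in notin_take_j.
case=> _; rewrite restrictB; apply: neqX; apply/eqP=> /mnmP /(_ (arr j)).
rewrite mnmE [X in _ = X]mnmE cycle_weight0 cycle_weightU mnm0E mem_seg //.
by rewrite take_j mem_rcons mem_head arr_J // eqxx.
Qed.

(* A minimal family [J] of cycles of [u] covering [cyc i] has a private arrow
   on [cyc i] for each member, so it is a proper part of [u]. *)
Lemma cycle_exchange d i u :
  krull_dim (quiver_invariant src tgt) d -> (d <= mdeg u)%N ->
  (weight U_(i) <= weight u)%MM -> (0 < u i)%N \/
  exists w j, [/\ weight w = weight u, (0 < w i)%N, (0 < w j)%N & (0 < u j)%N].
Proof.
move=> dimd le_du /mnm_lepP le_iu.
pose covers J := cyc i \subset \bigcup_(j in J) cyc j.
have cover_u : covers [set j | 0 < u j]%N.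
  apply/subsetP=> a ia; have := le_iu a; rewrite cycle_weightU ia lt0n.
  rewrite cycle_weightE sum_nat_eq0 negb_forall => /existsP[j] /=.
  rewrite muln_eq0 negb_or eqb0 negbK -lt0n => /andP[uj ja].
  by apply/bigcupP; exists j; rewrite ?inE.
have [J /minsetP[covJ minJ] sJu] := minset_exists cover_u.
have uJ j : j \in J -> (0 < u j)%N by move/(subsetP sJu); rewrite inE.
have [Ji|J'i] := boolP (i \in J); [by left; apply: uJ | right].
have /set0Pn[a0 ia0] := prim_cycle_neq0 (cyc_prim i).
have J_neq0 : J != set0.
  by have /bigcupP[j Jj _] := subsetP covJ a0 ia0; apply/set0Pn; exists j.
pose private j a := (a \in cyc i) && (a \notin \bigcup_(k in J :\ j) cyc k).
(* Without a private arrow, [j] could be removed from the minimal cover; so for [j] in [J] the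
   default [a0] is not taken. *)
pose arr j := odflt a0 [pick a | private j a].
have arrP j : j \in J -> private j (arr j).
  move=> Jj; rewrite /arr; case: pickP => //= none.
  have /minJ /(_ (subD1set J j)) eqJ : covers (J :\ j).
    apply/subsetP=> a ia; have := none a; rewrite /private ia /=.
    by move/negbFE.
  by move: Jj; rewrite -eqJ !inE eqxx.
have arr_J : {in J &, forall j j', (arr j \in cyc j') = (j == j')}.
  have arr_notin j j' : j \in J -> j' \in J -> arr j \in cyc j' -> j == j'.
    move=> /arrP /andP[_ nj] Jj' jj'; apply: contraR nj => neq_jj'.
    by apply/bigcupP; exists j'; rewrite // !inE eq_sym neq_jj'.
  move=> j j' Jj Jj'; apply/idP/eqP => [/(arr_notin _ _ Jj Jj')/eqP //|<-].
  (* [arr j] lies on [cyc i], hence on some member of [J], which privacy forces to be [j]. *)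
  have /andP[ij _] := arrP j Jj.
  have /bigcupP[k Jk jk] := subsetP covJ _ ij.
  by rewrite {2}(eqP (arr_notin _ _ Jj Jk jk)).
have ltJd : (#|J| < d)%N.
  by apply: (private_arrows_lt_dim dimd J_neq0 J'i) arr_J => j /arrP /andP[].
have le_Ju : (mnm_set J <= u)%MM.
  by apply/mnm_lepP=> j; rewrite mnmE; case: (boolP (j \in J)) => // /uJ.
have le_iJ : (weight U_(i) <= weight (mnm_set J))%MM.
  apply/mnm_lepP=> a; rewrite cycle_weightU cycle_weight_set.
  case: (boolP (a \in cyc i)) => // /(subsetP covJ) /bigcupP[j Jj ja].
  by rewrite (bigD1 j) //= ja.
have [e we] : exists e, weight e = (weight (mnm_set J) - weight U_(i))%MM.
  by apply/circulation_weight/circulationB => //;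
     apply: cyc_weight_circulation.
(* [J] has fewer than [d] members and [u] at least [d] with multiplicity, so a cycle of [u] survives
   the exchange. *)
have /existsP[j uj] : [exists j, 0 < (u - mnm_set J)%MM j]%N.
  rewrite -mnm_neq0; apply: contraTneq (leq_trans ltJd le_du) => sub0.
  by rewrite -(submK le_Ju) sub0 add0m mdeg_mnm_set ltnn.
exists (e + U_(i) + (u - mnm_set J))%MM, j; split.
- by rewrite !cycle_weightD we submK // -cycle_weightD addmC submK.
- by rewrite !mnmDE mnm1E eqxx addn1.
- by rewrite mnmDE ltn_addl.
by apply: leq_trans uj _; rewrite mnmBE leq_subr.
Qed.

(** The induction is on the degree of the weight: an exchange preserves the weight but may change
    the number of cycles. *)
Lemma weight_binomials d (I : {mpoly CC[N]} -> Prop) :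
  krull_dim (quiver_invariant src tgt) d -> (0 < d)%N ->
  I 0 -> (forall p q, I p -> I q -> I (p + q)) ->
  (forall p q, I q -> I (p * q)) ->
  (forall u v, weight u = weight v -> (mdeg u < d)%N -> (mdeg v < d)%N ->
     I ('X_[u] - 'X_[v])) ->
  forall u v, weight u = weight v -> I ('X_[u] - 'X_[v]).
Proof.
move=> dimd d_gt0 I0 ID IM Igen u v.
have [n] := ubnP (mdeg (weight u)); elim: n u v => // n IHn u v lt_un eq_uv.
have Isym x y : I ('X_[x] - 'X_[y]) -> I ('X_[y] - 'X_[x]).
  by move=> Ixy; rewrite -opprB -mulN1r; apply: IM.
have Itrans y x z : I ('X_[x] - 'X_[y]) -> I ('X_[y] - 'X_[z]) ->
    I ('X_[x] - 'X_[z]).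
  by move=> Ixy Iyz; rewrite -(subrKA 'X_[y]); apply: ID.
(* Dividing by the shared variable lowers the weight, as a cycle has at least one arrow. *)
have share j x y : (mdeg (weight x) < n.+1)%N -> weight x = weight y ->
    (0 < x j)%N -> (0 < y j)%N -> I ('X_[x] - 'X_[y]).
  move=> lt_xn eq_xy; rewrite !lt0n -!lep1mP => le_jx le_jy.
  have pos_j : (0 < mdeg (weight U_(j)))%N.
    rewrite lt0n mdeg_eq0; apply/eqP=> /weight_eq0 /eqP.
    by rewrite -mdeg_eq0 mdeg1.
  move: lt_xn eq_xy; rewrite -(submK le_jx) -(submK le_jy).
  rewrite !cycle_weightD mdegD !mpolyXD -mulrBl mulrC => lt_xn /addIm eq_xy.
  apply/IM/IHn => //; rewrite -ltnS; apply: leq_trans lt_xn.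
  by rewrite ltnS -addn1 leq_add2l.
have main x y : (mdeg (weight x) < n.+1)%N -> weight x = weight y ->
    (d <= mdeg x)%N -> I ('X_[x] - 'X_[y]).
  move=> lt_xn eq_xy le_dx.
  (* If [y] were 0, then [x] would have weight 0 and be 0, against [0 < d <= mdeg x]. *)
  have /existsP[i yi] : [exists i, 0 < y i]%N.
    rewrite -mnm_neq0; apply: contraTneq (leq_trans d_gt0 le_dx) => y0.
    move: eq_xy; rewrite y0 cycle_weight0 => /weight_eq0 ->.
    by rewrite mdeg0.
  have le_ix : (weight U_(i) <= weight x)%MM.
    have le_iy : (U_(i) <= y)%MM by rewrite lep1mP -lt0n.
    by rewrite eq_xy -(submK le_iy) cycle_weightD lem_addl.
  have [xi|[w [j [eq_wx wi wj xj]]]] := cycle_exchange dimd le_dx le_ix.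
    exact: share xi yi.
  apply: (Itrans w); first by apply: share xj wj.
  by apply: share wi yi; rewrite eq_wx.
have [lt_ud|] := ltnP (mdeg u) d; last exact: main.
have [lt_vd|] := ltnP (mdeg v) d; first exact: Igen.
by move=> le_dv; apply/Isym/main; rewrite -?eq_uv.
Qed.

End PrimitiveCycleRelations.

Theorem theorem9p6 (V : finType) (m : nat) (src tgt : 'I_m -> V)
    (N : nat) (cyc : 'I_N -> {set 'I_m}) :
  injective cyc ->
  (forall C : {set 'I_m}, is_prim_cycle src tgt C <-> exists i, cyc i = C) ->
  forall d : nat, krull_dim (quiver_invariant src tgt) d -> (0 < d)%N ->
  exists (k : nat) (gen : 'I_k -> {mpoly CC[N]}),
    (forall j, (msize (gen j) <= d)%N) /\
    (forall p : {mpoly CC[N]},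
       prim_cycle_map cyc p = 0 <->
       exists r : 'I_k -> {mpoly CC[N]}, p = \sum_(j < k) r j * gen j).
Proof.
move=> cyc_inj cycP d dimd d_gt0.
(* There are finitely many pairs of exponents of degree below [d]; a pair of unequal weights
   contributes the generator 0. *)
pose T : finType := ('X_{1..N < d} * 'X_{1..N < d})%type.
pose bin (t : T) : {mpoly CC[N]} :=
  if cycle_weight cyc t.1 == cycle_weight cyc t.2
  then 'X_[t.1] - 'X_[t.2] else 0.
pose gen (j : 'I_#|T|) := bin (enum_val j).
exists #|T|, gen; split=> [j|p].
  (* For a nonzero polynomial [msize] is the degree plus one, so the bound [d] means degree at most
     [d - 1]. *)
  rewrite /gen /bin; case: ifP => _; last by rewrite msize0.
  apply: leq_trans (msizeD_le _ _) _; rewrite msizeN !msizeX geq_max.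
  by rewrite !bmdeg.
have gen0 j : prim_cycle_map cyc (gen j) = 0.
  rewrite /gen /bin; case: eqP => [eq_w|_]; last exact: raddf0.
  by rewrite /prim_cycle_map raddfB /= -!/(prim_cycle_map cyc _) !prim_cycle_mapX
             eq_w subrr.
split=> [|[r ->]]; last first.
  rewrite /prim_cycle_map raddf_sum big1 //= => j _.
  by rewrite rmorphM /= -/(prim_cycle_map cyc (gen j)) gen0 mulr0.
pose I (q : {mpoly CC[N]}) :=
  exists r : 'I_#|T| -> {mpoly CC[N]}, q = \sum_(j < #|T|) r j * gen j.
have I0 : I 0 by exists (fun _ => 0); rewrite big1 // => j _; rewrite mul0r.
have ID q1 q2 : I q1 -> I q2 -> I (q1 + q2).
  move=> [r1 ->] [r2 ->]; exists (fun j => r1 j + r2 j).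
  by rewrite -big_split; apply: eq_bigr => j _; rewrite mulrDl.
have IM q1 q2 : I q2 -> I (q1 * q2).
  move=> [r ->]; exists (fun j => q1 * r j).
  by rewrite mulr_sumr; apply: eq_bigr => j _; rewrite mulrA.
apply: (prim_cycle_map_kernel I0 ID IM).
apply: (weight_binomials cyc_inj cycP dimd d_gt0 I0 ID IM) => u v eq_uv ltu ltv.
pose t : T := (BMultinom ltu, BMultinom ltv).
exists (fun j => (j == enum_rank t)%:R).
rewrite (bigD1 (enum_rank t)) //= eqxx mul1r big1 ?addr0 => [|j /negbTE ->].
  by rewrite /gen enum_rankK /bin /= eq_uv eqxx.
by rewrite mul0r.
Qed.
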